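(* Let $X$ be an infinite set and let $s : X \to X$ be a bijection without cycles (i.e. $s^n(x) \neq x$ for all $x \in X$ and all integers $n \ge 1$). Let $\mathcal{C}_1 := \mathrm{Pol}(s)$. Then the map $n \mapsto \mathrm{Pol}(s^n)$ is a lattice isomorphism between the following two lattices: (i) $(\mathbb{N}, \mid)$, the natural numbers $\{0,1,2,\ldots\}$ with the divisibility relation, in which $1$ is the smallest and $0$ the greatest element; (ii) $([\mathcal{C}_1, \mathcal{O}], \subseteq)$, the set of all local clones on $X$ that contain $\mathcal{C}_1$; this set is an interval in the lattice of local clones on $X$. In particular, there is no precomplete local clone above $\mathcal{C}_1$. Moreover, if $s$ has infinitely many components, then $(X, s) \simeq (X, s^n)$ for all $n \neq 0$, so all local clones $\mathcal{C}$ with $\mathcal{C}_1 \subseteq \mathcal{C} \subsetneq \mathcal{O}$ are isomorphic, i.e. conjugate to each other via permutations of $X$.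
   Context: Let $X$ be a nonempty set. $\mathcal{O}^{(n)}$ is the set of all functions $X^n \to X$ ($n \ge 1$), and $\mathcal{O} = \bigcup_{n\ge 1} \mathcal{O}^{(n)}$ is the full clone. A clone on $X$ is a set $\mathcal{C} \subseteq \mathcal{O}$ which contains all projections and is closed under composition. A clone $\mathcal{C}$ is a local clone if for every $k \ge 1$ the set $\mathcal{C} \cap \mathcal{O}^{(k)}$ is closed in the product topology on $X^{X^k}$ ($X$ discrete); equivalently: whenever $f \in \mathcal{O}^{(k)}$ and for every finite $A \subseteq X^k$ there is $g \in \mathcal{C} \cap \mathcal{O}^{(k)}$ with $g|_A = f|_A$, then $f \in \mathcal{C}$. The local clones on $X$ form, under inclusion, a complete lattice with largest element $\mathcal{O}$; its coatoms (the maximal elements among local clones $\ne \mathcal{O}$) are called precomplete local clones. For a bijection $s: X \to X$ and $n \in \mathbb{Z}$, $s^n$ is the $n$-th iterate of $s$ ($s^0$ is the identity, $s^{-n}$ the inverse of $s^n$). The components of $s$ are its orbits, i.e. the sets $\{s^n(x) : n \in \mathbb{Z}\}$. $\mathrm{Pol}(s^n)$ is the set of all $f \in \mathcal{O}$, say $k$-ary, such that $f(s^n(a_1), \ldots, s^n(a_k)) = s^n(f(a_1, \ldots, a_k))$ for all $(a_1,\ldots,a_k) \in X^k$; it is a local clone, and $\mathrm{Pol}(s^0) = \mathcal{O}$. $(X,s) \simeq (X,s^n)$ means there is a bijection $\varphi: X \to X$ with $\varphi \circ s = s^n \circ \varphi$. Two clones $\mathcal{C}, \mathcal{C}'$ on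 $X$ are conjugate via a permutation $\pi$ of $X$ if $\mathcal{C}' = \{ (x_1,\dots,x_k) \mapsto \pi(f(\pi^{-1}(x_1), \ldots, \pi^{-1}(x_k))) : f \in \mathcal{C},\ f \text{ } k\text{-ary},\ k \ge 1\}$. *)

(* Defs.v *)
From HB Require Import structures.
From mathcomp Require Import all_boot all_order all_algebra.
From mathcomp Require Import boolp classical_sets functions cardinality.
From mathcomp Require Import topology function_spaces.

Set Implicit Arguments.
Unset Strict Implicit.
Unset Printing Implicit Defensive.

Import Order.TTheory.
Local Open Scope classical_set_scope.

(* Finitary operations of arity at least one: the index k stands for arity
   k.+1, and a tuple in X^(k.+1) is a function 'I_k.+1 -> X. *)
Definition operation (X : Type) := {k : nat & ('I_k.+1 -> X) -> X}.

Definition Op (X : Type) (k : nat) (f : ('I_k.+1 -> X) -> X) : operation X :=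
  existT _ k f.

Definition is_clone (X : Type) (C : set (operation X)) : Prop :=
  (forall (k : nat) (i : 'I_k.+1), C (Op (fun x : 'I_k.+1 -> X => x i))) /\
  (forall (k m : nat) (f : ('I_k.+1 -> X) -> X)
      (g : 'I_k.+1 -> ('I_m.+1 -> X) -> X),
    C (Op f) -> (forall i, C (Op (g i))) ->
    C (Op (fun x : 'I_m.+1 -> X => f (fun i => g i x)))).

(* {classic X} is X itself, with the choice structure that the topological
   types of the library require. *)
Definition operation_space (X : Type) (k : nat) :=
  {ptws ('I_k.+1 -> X) -> discrete_topology {classic X}}.

Definition is_local_clone (X : Type) (C : set (operation X)) : Prop :=
  is_clone C /\
  forall k : nat, closed ([set f | C (Op f)] : set (operation_space X k)).

Lemma nbhs_operationP (X : Type) (k : nat) (f : operation_space X k)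
    (B : set (operation_space X k)) :
  nbhs f B <->
  exists2 A : set ('I_k.+1 -> X), finite_set A &
    [set g | forall a, A a -> g a = f a] `<=` B.
Proof.
split; last first.
  case=> A /(@finite_seqP {classic _})[t ->] tB; apply: (@filterS _ (nbhs f) _ _ _ tB) => {tB}.
  elim: t => [|b t IHt].
    by apply: (@filterS _ (nbhs f) _ setT) => //; exact: filterT.
  have fb : nbhs f [set g : operation_space X k | g b = f b].
    have /cvg_sup/(_ b) : f --> f by apply: cvg_id.
    apply; exists [set g : operation_space X k | g b = f b] => //; split=> //.
    by exists [set f b] => //; exact: discrete_open.
  apply: (@filterS _ (nbhs f) _ _ _ _ (filterI fb IHt)) => g /= [gb gt] a.
  by rewrite inE => /predU1P[->//|/gt].
pose F : set_system (operation_space X k) :=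
  [set B | exists2 A : set ('I_k.+1 -> X), finite_set A &
     [set g | forall a, A a -> g a = f a] `<=` B].
have FF : Filter F.
  split.
  - by exists set0.
  - move=> P Q [A finA AP] [A' finA' AQ]; exists (A `|` A').
      by rewrite finite_setU.
    by move=> g gA; split; [apply: AP|apply: AQ] => a Aa; apply: gA; [left|right].
  - by move=> P Q PQ [A finA AP]; exists A => //; exact: subset_trans PQ.
suff : F --> f by exact.
apply/cvg_sup => a U /= [V [[W oW <-] Wf] WU].
exists [set a] => [|g ga]; first exact: finite_set1.
by apply: WU => /=; rewrite ga.
Qed.

Lemma closed_operationsP (X : Type) (k : nat) (C : set (operation_space X k)) :
  closed C <->
  forall f : operation_space X k,
    (forall A : set ('I_k.+1 -> X), finite_set A ->
       exists2 g, C g & forall a, A a -> g a = f a) -> C f.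
Proof.
split=> [clC f approx|approx f clf].
  apply: clC => B /nbhs_operationP[A finA AB].
  by have [g Cg gA] := approx _ finA; exists g; split=> //; exact: AB.
apply: approx => A finA.
have [|g [Cg gA]] := clf [set g | forall a, A a -> g a = f a].
  by apply/nbhs_operationP; exists A.
by exists g.
Qed.

Definition Pol_set (X : Type) (h : X -> X) : set (operation X) :=
  [set o | let: existT k f := o in
           forall a : 'I_k.+1 -> X, f (h \o a) = h (f a)].

Lemma Pol_local_clone (X : Type) (h : X -> X) : is_local_clone (Pol_set h).
Proof.
split; first split=> // k m f g hf hg a /=.
  by rewrite -hf; congr f; apply: funext => i; exact: hg.
move=> k; apply/closed_operationsP => f approx a /=.
have [|g hg gf] := approx ([set a] `|` [set h \o a]).
  by rewrite finite_setU; split; exact: finite_set1.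
by rewrite -(gf _ (or_introl erefl)) -(gf _ (or_intror erefl)) hg.
Qed.

Lemma bigcap_local_clone (X : Type) (F : set (set (operation X))) :
  F `<=` @is_local_clone X -> is_local_clone (\bigcap_(C in F) C).
Proof.
move=> FX; split; first split.
- by move=> k i C /FX[[]].
- move=> k m f g Cf Cg C FC; have [[_ Ccomp] _] := FX _ FC.
  by apply: Ccomp => [|i]; [exact: Cf|exact: Cg].
- move=> k; have -> : [set f | (\bigcap_(C in F) C) (Op f)] =
      \bigcap_(C in F) [set f : operation_space X k | C (Op f)] by [].
  by apply: closed_bigI => C /FX[].
Qed.

Lemma setT_local_clone (X : Type) : is_local_clone [set: operation X].
Proof. by split=> // k; exact: closedT. Qed.

Lemma setI_local_clone (X : Type) (C D : set (operation X)) :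
  is_local_clone C -> is_local_clone D -> is_local_clone (C `&` D).
Proof.
move=> hC hD.
have -> : C `&` D = \bigcap_(E in [set C; D]) E by rewrite bigcap_setU !bigcap_set1.
by apply: bigcap_local_clone => E [->|->].
Qed.

Lemma smallest_local_clone (X : Type) (G : set (operation X)) :
  is_local_clone (smallest (@is_local_clone X) G).
Proof. by apply: bigcap_local_clone => C []. Qed.

Record localClone (X : Type) := LocalClone {
  ops_of :> set (operation X);
  _ : `[< is_local_clone ops_of >] }.

Fact localClone_display : Order.disp_t. Proof. by []. Qed.

HB.instance Definition _ (X : Type) := [isSub for @ops_of X].
HB.instance Definition _ (X : Type) := [Choice of localClone X by <:].
HB.instance Definition _ (X : Type) :=
  Order.SubChoice_isSubPOrder.Build set_display (set (operation X)) _
    localClone_display (localClone X).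

Section Lattice.
Variable X : Type.
Implicit Types C D E : localClone X.

Lemma localCloneP C : is_local_clone C.
Proof. exact/asboolP/(valP C). Qed.

Lemma le_localCloneE C D : (C <= D)%O = (C `<=` D) :> Prop.
Proof. by rewrite -[(C <= D)%O]/(ops_of C <= ops_of D)%O subsetEset. Qed.

Definition localClone_top := LocalClone (asboolT (@setT_local_clone X)).

Definition localClone_meet C D := LocalClone
  (asboolT (setI_local_clone (localCloneP C) (localCloneP D))).

Definition localClone_join C D := LocalClone
  (asboolT (@smallest_local_clone X (C `|` D))).

Lemma localClone_meetP C D E :
  (C <= localClone_meet D E)%O = (C <= D)%O && (C <= E)%O.
Proof.
by apply/idP/andP; rewrite !le_localCloneE subsetI.
Qed.

Lemma localClone_joinP C D E :
  (localClone_join C D <= E)%O = (C <= E)%O && (D <= E)%O.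
Proof.
apply/idP/andP; rewrite !le_localCloneE /=.
  move=> CDE; have : C `|` D `<=` E.
    by apply: subset_trans CDE; exact: sub_gen_smallest.
  by rewrite subUset.
by case=> CE DE; apply: smallest_sub; [exact: localCloneP | rewrite subUset].
Qed.

Lemma localClone_le_top C : (C <= localClone_top)%O.
Proof. by rewrite le_localCloneE; exact: subsetT. Qed.

HB.instance Definition _ :=
  Order.POrder_MeetJoin_isLattice.Build localClone_display (localClone X)
    localClone_meetP localClone_joinP.
HB.instance Definition _ :=
  Order.hasTop.Build localClone_display (localClone X) localClone_le_top.

End Lattice.

Definition Pol (X : Type) (h : X -> X) : localClone X :=
  LocalClone (asboolT (Pol_local_clone h)).

Definition precomplete (X : Type) (C : localClone X) : Prop :=
  C <> \top%O /\ forall D, (C <= D)%O -> D = C \/ D = \top%O.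

(* A bijection of X bundled with its inverse s^-1. *)
Notation permutation X := {splitbij [set: X] >-> [set: X]}.

Definition iterz (X : Type) (s : permutation X) (n : int) : X -> X :=
  match n with
  | Posz k => iter k s
  | Negz k => iter k.+1 (s^-1)%FUN
  end.

Definition component (X : Type) (s : permutation X) (x : X) : set X :=
  range (fun n : int => iterz s n x).

Definition components (X : Type) (s : permutation X) : set (set X) :=
  range (component s).

Definition isomorphic (X : Type) (f g : X -> X) : Prop :=
  exists phi : permutation X, phi \o f = g \o phi.

Definition conj_op (X : Type) (p : permutation X) (o : operation X) :
    operation X :=
  let: existT k f := o in
  Op (fun x : 'I_k.+1 -> X => p (f ((p^-1)%FUN \o x))).

Definition conjugate (X : Type) (C D : set (operation X)) : Prop :=
  exists p : permutation X, D = conj_op p @` C.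

(* Main.v *)
(* For a local clone C containing Pol(s), the integers n such that s^n commutes
   with every member of C form a subgroup dZ of Z, so C is contained in Pol(s^d).
   Conversely let f be in Pol(s^d).  Since s acts freely, members of Pol(s) can
   be prescribed arbitrarily on orbit representatives; so whenever n is not in
   dZ, some u in C has u(s^n a) <> s^n u(a).  Adjoining finitely many such u as
   extra arguments, one interpolates f on any finite set by a member of Pol(s)
   composed with members of C, and f is in C because C is local.
   If s has infinitely many orbits, their set can be partitioned into countably
   infinite blocks, and the |n| orbits of s^n inside each orbit of s are
   absorbed by a renumbering of each block. *)
Require Import Defs.
From mathcomp Require Import all_boot all_order all_algebra.
From mathcomp Require Import boolp classical_sets functions cardinality.
From mathcomp Require Import topology zify.
Local Open Scope classical_set_scope.

Set Implicit Arguments.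
Unset Strict Implicit.
Unset Printing Implicit Defensive.

Import Order.TTheory GRing.Theory Num.Theory.

Local Open Scope ring_scope.

(** * Subgroups of the integers *)

Lemma int_subgroup_generator (H : set int) :
  H 0 -> (forall m n, H m -> H n -> H (m - n)) ->
  exists d : nat, forall n, H n <-> (d %| n)%Z.
Proof.
move=> H0 HB.
have HN n : H n -> H (- n) by move=> Hn; rewrite -sub0r; exact: HB.
have HD m n : H m -> H n -> H (m + n).
  by move=> Hm Hn; rewrite -[n]opprK; apply: HB => //; exact: HN.
have HM m k : H m -> H (k * m).
  move=> Hm; elim/int_ind: k => [|k IHk|k IHk]; first by rewrite mul0r.
    by rewrite intS mulrDl mul1r; exact: HD.
  by rewrite intS opprD mulrDl mulN1r; apply: HD => //; exact: HN.
have [[n n0 Hn]|noH] := pselect (exists2 n : nat, (0 < n)%N & H n%:Z).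
  have exH : exists n, (0 < n)%N && `[< H n%:Z >].
    by exists n; rewrite n0; apply/asboolP.
  have [d /andP[d0 /asboolP Hd] dmin] := ex_minnP exH.
  exists d => k; split=> [Hk|/dvdzP[q ->]]; last exact: HM.
  have Hr : H (k %% d)%Z by apply: HB => //; exact: HM.
  apply/dvdz_mod0P; have d_gt0 : (0 < d%:Z) by [].
  have := ltz_pmod k d_gt0; have := modz_ge0 k (lt0r_neq0 d_gt0).
  case: (k %% d)%Z Hr => [[//|r]|//] Hr _.
  by rewrite ltz_nat ltnNge dmin //=; apply/asboolP.
(* [H] has no positive element, hence, by closure under negation, no nonzero one. *)
exists 0%N => n; rewrite dvd0z; split=> [Hn|/eqP->//].
have [//|nn0] := eqVneq; exfalso; apply: noH; exists `|n|%N.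
  by rewrite absz_gt0.
by case: n Hn {nn0} => [//|n /HN].
Qed.

(** * Integer iterates of s and the clones Pol(s^n) *)

Section Iterates.
Variables (X : Type) (s : permutation X).

Lemma permutationK : cancel s (s^-1)%FUN.
Proof. by move=> x; apply: funK; exact: mem_set. Qed.

Lemma permutationVK : cancel (s^-1)%FUN s.
Proof. by move=> x; apply: invK; exact: mem_set. Qed.

Lemma iterz1D n x : iterz s (1 + n) x = s (iterz s n x).
Proof. by case: n => [n|[|n]] //=; rewrite ?subn1 permutationVK. Qed.

Lemma permutation_inj : injective s.
Proof. exact: can_inj permutationK. Qed.

Lemma iterzD m n x : iterz s (m + n) x = iterz s m (iterz s n x).
Proof.
elim/int_ind: m => [|m IHm|m IHm]; first by rewrite add0r.
  by rewrite intS -addrA !iterz1D IHm.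
apply: permutation_inj; rewrite -!iterz1D intS addrA.
by rewrite opprD !addrA subrr !add0r.
Qed.

Lemma iterzNK n : cancel (iterz s n) (iterz s (- n)).
Proof. by move=> x; rewrite -iterzD addNr. Qed.

Lemma iterzVK n : cancel (iterz s (- n)) (iterz s n).
Proof. by move=> x; rewrite -iterzD addrN. Qed.

Lemma iterz_comp_flip k (a b : 'I_k.+1 -> X) n :
  b = iterz s n \o a -> a = iterz s (- n) \o b.
Proof. by move=> ->; apply/funext => i /=; rewrite iterzNK. Qed.

(** This makes the exponents n for which s^n commutes with a given operation a subgroup of Z. *)
Lemma Pol_set_iterzB m n :
  Pol_set (iterz s m) `&` Pol_set (iterz s n) `<=` Pol_set (iterz s (m - n)).
Proof.
move=> [k f] [/= fm fn] a.
have -> : iterz s (m - n) \o a = iterz s m \o (iterz s (- n) \o a).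
  by apply/funext => i; rewrite /= iterzD.
rewrite fm iterzD; congr (iterz s m _).
apply: (can_inj (iterzNK n)); rewrite iterzVK -fn; congr f.
by apply/funext => i /=; rewrite iterzVK.
Qed.

Lemma Pol_set_iterz0 : Pol_set (iterz s 0) = setT.
Proof. by apply/seteqP; split=> // -[k f]. Qed.

Lemma Pol_set_iterz_dvd (m n : int) :
  (m %| n)%Z -> Pol_set (iterz s m) `<=` Pol_set (iterz s n).
Proof.
move=> + f fm.
have [||d dP] := @int_subgroup_generator [set n | Pol_set (iterz s n) f].
- by rewrite /= Pol_set_iterz0.
- by move=> p q fp fq; apply: Pol_set_iterzB.
by move=> mn; apply/dP/(dvdz_trans _ mn)/dP.
Qed.

Lemma iterz_period_generator (C : set (operation X)) :
  exists d : nat, forall n, C `<=` Pol_set (iterz s n) <-> (d %| n)%Z.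
Proof.
apply: int_subgroup_generator => [|m n Cm Cn f Cf].
  by rewrite Pol_set_iterz0.
by apply: Pol_set_iterzB; split; [exact: Cm|exact: Cn].
Qed.

(* Prescribed values on orbit representatives, and the first projection off
   the orbits of D. *)
Lemma Pol_extension k (D : set ('I_k.+1 -> X)) (phi : ('I_k.+1 -> X) -> X) :
  (forall a b n, D a -> D b -> b = iterz s n \o a -> phi b = iterz s n (phi a)) ->
  exists h, Pol_set s (Op h) /\ forall a, D a -> h a = phi a.
Proof.
move=> phiP.
pose hits x (p : ('I_k.+1 -> X) * int) := D p.1 /\ x = iterz s p.2 \o p.1.
have hP x : exists y, (forall p, hits x p -> y = iterz s p.2 (phi p.1)) /\
    ((forall p, ~ hits x p) -> y = x ord0).
  have [[[a n] [Da ->]]|nohit] := pselect (exists p, hits x p).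
    exists (iterz s n (phi a)); split; last by move=> /(_ (a, n))[].
    move=> [b m] [/= Db eq_ab].
    rewrite (phiP a b (- m + n)) -?iterzD ?addrA ?subrr ?add0r //.
    rewrite (iterz_comp_flip eq_ab); apply/funext => i /=.
    by rewrite -iterzD.
  exists (x ord0); split=> // p xp; exfalso.
  by apply: nohit; exists p.
have [h {}hP] := choice hP; exists h; split=> [x|a Da]; last first.
  by rewrite ((hP a).1 (a, 0)).
have [[[a n] [/= Da xE]]|nohit] := pselect (exists p, hits x p).
  rewrite ((hP x).1 (a, n)) // ((hP _).1 (a, 1 + n)) ?iterz1D //; split=> //=.
  by apply/funext => i /=; rewrite iterz1D xE.
rewrite ((hP x).2) => [|p xp]; last by apply: nohit; exists p.
rewrite ((hP _).2) // => -[a n] [/= Da xE].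
apply: nohit; exists (a, - 1%:Z + n); split=> //=; apply/funext => i /=.
have /(congr1 (fun f => f i)) /= := xE; rewrite iterzD => <-.
by rewrite (iterzNK 1).
Qed.

End Iterates.

(** * Local clones above Pol(s) for acyclic s *)

Section LocalClonesAbovePol.
Variables (X : Type) (s : permutation X).
Hypothesis s_acyclic : forall (x : X) (n : int), 1 <= n -> iterz s n x <> x.

Lemma iterz_fixed n x : iterz s n x = x -> n = 0.
Proof.
move=> nx; have [n0|n0|//] := ltrgt0P n.
  by case: (s_acyclic (x := x) (n := n)); rewrite // -gtz0_ge1.
case: (s_acyclic (x := x) (n := - n)); first by rewrite -gtz0_ge1 oppr_gt0.
by rewrite -[in LHS]nx iterzNK.
Qed.

Lemma iterz_injl m n x : iterz s m x = iterz s n x -> m = n.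
Proof.
move=> mn; apply/subr0_eq/(@iterz_fixed _ x).
by rewrite addrC iterzD mn iterzNK.
Qed.

(** For a single tuple the compatibility condition of [Pol_extension] is vacuous: a = s^n a forces n
    = 0. *)
Lemma Pol_transitive k (a : 'I_k.+1 -> X) x :
  exists h, Pol_set s (Op h) /\ h a = x.
Proof.
have [|h [hs ha]] := @Pol_extension X s k [set a] (fun=> x).
  move=> _ _ n -> -> /(congr1 (fun f => f ord0)) /= /esym/iterz_fixed -> //.
by exists h; split=> //; exact: ha.
Qed.

(** By acyclicity at most one n satisfies b = s^n a. If some f in C fails to commute with s^n at c,
    choose e_i in Pol(s) with e_i(a) = c_i. Then u = f(e_0, ..., e_m) has u(a) = f(c) and u(b) =
    f(s^n c), which moves the failure to a. *)
Lemma clone_separates (C : set (operation X)) k (a b : 'I_k.+1 -> X) :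
  is_clone C -> Pol_set s `<=` C ->
  exists u, C (Op u) /\ forall n, b = iterz s n \o a ->
    u b = iterz s n (u a) -> C `<=` Pol_set (iterz s n).
Proof.
move=> [Cproj Ccomp] sC.
have [[n [-> nC]]|sep] := pselect (exists n, b = iterz s n \o a /\
    ~ (C `<=` Pol_set (iterz s n))); last first.
  (* Here every s^n taking a to b commutes with C, so any member of C would do. *)
  exists (fun x => x ord0); split=> [|n ba _]; first exact: Cproj.
  by apply: contrapT => nC; apply: sep; exists n.
have [[m f] [Cf /existsNP[c fc]]] : exists o, C o /\ ~ Pol_set (iterz s n) o.
  by apply: contrapT => no; apply: nC => o Co; apply: contrapT => on; apply: no; exists o.
have [e eP] := choice (fun i => Pol_transitive a (c i)).
exists (fun x => f (e^~ x)); split=> [|p pn].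
  by apply: Ccomp => // i; apply: sC; case: (eP i).
have -> : p = n.
  by have /(congr1 (fun f => f ord0)) /esym/iterz_injl := pn.
have eE x i : e i (iterz s n \o x) = iterz s n (e i x).
  by apply: (@Pol_set_iterz_dvd _ s 1 n (dvd1z n) (Op (e i))); case: (eP i).
have -> : e^~ a = c by apply/funext => i; case: (eP i).
by have -> : e^~ (iterz s n \o a) = iterz s n \o c
  by apply/funext => i /=; rewrite eE; case: (eP i) => _ ->.
Qed.

(* Tx adjoins to x the values at x of separating members of C, so that
   Tx b = s^n (Tx a) forces b = s^n a with s^n commuting with C; hence f, read
   off on the tuples Tx x, extends to some h in Pol(s), and h o Tx is in C. *)
Lemma Pol_iterz_sub_local_clone (C : set (operation X)) (d : nat) :
  is_local_clone C -> Pol_set s `<=` C ->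
  (forall n, C `<=` Pol_set (iterz s n) -> (d %| n)%Z) ->
  Pol_set (iterz s d) `<=` C.
Proof.
move=> [cC clC] sC dP [k f] fd.
apply: ((closed_operationsP _).1 (clC k) f) => A.
move=> /(@finite_seqP {classic _})[e ->].
have [u uP] := choice (fun ab : _ * _ => @clone_separates C k ab.1 ab.2 cC sC).
pose proj i : {classic ('I_k.+1 -> X) -> X} := @^~ i.
pose sep (a b : {classic _}) : {classic ('I_k.+1 -> X) -> X} := u (a, b).
(* The projections make [Tx x] determine x; the rest is one separating operation for each pair of
   points of the finite set. *)
pose t := map proj (enum 'I_k.+1) ++ allpairs sep e e.
have projt i : proj i \in t by rewrite mem_cat map_f ?mem_enum.
have sept a b : a \in e -> b \in e -> sep a b \in t.
  by move=> ae be; rewrite mem_cat allpairs_f ?orbT.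
have Ct v : v \in t -> C (Op v).
  rewrite mem_cat => /orP[/mapP[i _ ->]|/allpairsP[[a b] [_ _ ->]]].
    by have [Cproj _] := cC; exact: Cproj.
  by case: (uP (a, b)).
(* The default of [nth] matters: arities are successors, so [Tx] has a slot of index [size t],
   filled by the first projection. *)
pose T i : ('I_k.+1 -> X) -> X := nth (proj ord0) t i.
have CT i : C (Op (T i)).
  have [it|it] := ltnP i (size t); first exact/Ct/mem_nth.
  by rewrite /T nth_default //; exact: Ct.
have Tindex (v : {classic _}) x : v \in t -> T (index v t) x = v x.
  by move=> vt; rewrite /T nth_index.
pose Tx x (i : 'I_(size t).+1) := T i x.
pose ind v : 'I_(size t).+1 := inord (index v t).
have Txind v x : v \in t -> Tx x (ind v) = v x.
  by move=> vt; rewrite /Tx inordK ?Tindex // ltnS index_size.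
pose f' y := f (fun i => y (ind (proj i))).
have f'Tx x : f' (Tx x) = f x.
  by congr f; apply/funext => i; rewrite Txind.
have [|h [hs hf]] := @Pol_extension X s _ (Tx @` [set` e]) f'.
  move=> _ _ n [a ae <-] [b be <-] ban; rewrite !f'Tx.
  have vban v : v \in t -> v b = iterz s n (v a).
    by move=> vt; rewrite -!Txind // ban.
  have ba : b = iterz s n \o a by apply/funext => i; exact: (vban (proj i)).
  rewrite [in LHS]ba; apply: (@Pol_set_iterz_dvd _ s d n _ (Op f)) => //.
  by apply/dP/(uP (a, b)).2 => //; exact/vban/sept.
exists (fun x => h (Tx x)) => [|a ae]; last by rewrite hf ?f'Tx//; exists a.
by have [_ Ccomp] := cC; apply: Ccomp => //; exact: sC.
Qed.

(* The witness when m does not divide n is the identity on the s^m-orbit of x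
   and s elsewhere. *)
Lemma Pol_iterz_subP (x : X) (m n : int) :
  Pol_set (iterz s m) `<=` Pol_set (iterz s n) <-> (m %| n)%Z.
Proof.
split=> [mn|]; last exact: Pol_set_iterz_dvd.
pose orb y := exists j, y = iterz s (j * m) x.
pose f (a : 'I_1 -> X) := if `[< orb (a ord0) >] then a ord0 else s (a ord0).
have orbm y : orb (iterz s m y) <-> orb y.
  split=> -[j yE].
    by exists (- 1 + j); rewrite mulrDl mulN1r iterzD -yE iterzNK.
  by exists (1 + j); rewrite mulrDl mul1r iterzD yE.
have /mn/(_ (fun=> x)) : Pol_set (iterz s m) (Op f).
  move=> a; rewrite /f /= (asbool_equiv_eq (orbm _)); case: asboolP => // _.
  by rewrite -iterz1D addrC iterzD.
(* f fixes x, so f(s^n x) = s^n x; off the s^m-orbit of x this would read s^(n+1) x = s^n x. *)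
rewrite /f /=; case: asboolP => [[j nj] _|_].
  by apply/dvdzP; exists j; exact: iterz_injl nj.
case: asboolP => [_|[]]; last by exists 0; rewrite mul0r.
by rewrite -iterz1D => /iterz_injl/(congr1 (fun j => j - n)); rewrite addrK subrr.
Qed.

Lemma local_clone_above_Pol (C : localClone X) :
  Pol_set s `<=` C -> exists d : nat, C = Pol (iterz s d).
Proof.
move=> sC; have [d dP] := iterz_period_generator s C.
exists d; apply/val_inj/seteqP; split; first exact: (dP d).2 (dvdzz d).
apply: (Pol_iterz_sub_local_clone (localCloneP C) sC) => n.
by move/dP.
Qed.

End LocalClonesAbovePol.

(** * Partition of an infinite set into countably infinite blocks *)

Lemma infinite_set_inj_nat (T : Type) (A : set T) : infinite_set A ->
  exists2 e : nat -> T, injective e & forall i, A (e i).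
Proof.
elim/Ppointed: T => T in A *; first by rewrite emptyE => /(_ (finite_set0 _)).
move=> /infiniteP/pcard_leP[e]; exists e => [i j|i]; last exact: funS.
by apply: inj; exact: mem_set.
Qed.

Lemma countable_infinite_enum (T : Type) (A : set T) :
  countable A -> infinite_set A -> exists2 e : nat -> T, injective e & range e = A.
Proof.
elim/Ppointed: T => T in A *; first by rewrite emptyE => _ /(_ (finite_set0 _)).
move=> cA iA; have /card_esym/card_set_bijP[e [efun einj esurj]] := eq_card_nat cA iA.
exists e => [i j|]; first by apply: einj; exact: mem_set.
by apply/seteqP; split=> // _ [i _ <-]; exact: efun.
Qed.

(* Zorn: a maximal disjoint family of countably infinite subsets of A misses
   only finitely many points, which are then thrown into one of the blocks. *)
Lemma infinite_set_nat_blocks (T : Type) (A : set T) : infinite_set A ->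
  exists (J : Type) (e : J -> nat -> T),
    [/\ forall j i, A (e j i),
        forall x, A x -> exists j i, e j i = x &
        forall j j' i i', e j i = e j' i' -> j = j' /\ i = i'].
Proof.
move=> infA.
pose block (K : set T) := [/\ K `<=` A, countable K & infinite_set K].
pose disj (F : set (set T)) := forall K K' x, F K -> F K' -> K x -> K' x -> K = K'.
have [|F [[Fblock Fdisj] Fmax]] := @Zorn_bigcup (set T)
    [set F | F `<=` block /\ disj F].
  move=> G GP Gtot; split=> [K [F GF FK]|K K' x [F GF FK] [F' GF' FK'] Kx K'x].
    by case: (GP _ GF) => + _; exact.
  have [FF'|F'F] := Gtot _ _ GF GF'.
    by apply: (GP _ GF').2 Kx K'x => //; exact: FF'.
  by apply: (GP _ GF).2 Kx K'x => //; exact: F'F.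
pose L := A `\` \bigcup_(K in F) K.
have finL : finite_set L.
  apply: contrapT => /infinite_set_inj_nat[e einj Le].
  have nFe : ~ F (range e).
    by move=> Fe; have [_ []] := Le 0%N; exists (range e) => //; exists 0%N.
  apply: (Fmax (F `|` [set range e])).
    by split=> [K FK|/(_ (range e))]; [left|move=> FeF; apply/nFe/FeF; right].
  split=> [K [/Fblock//|->]|K K' x].
    split=> [_ [i _ <-]||]; first by case: (Le i).
      exact: sub_countable (card_image_le _ _) (countableP _).
    rewrite (eq_finite_set (inj_card_eq _)); first exact: infinite_nat.
    by move=> i j _ _; exact: einj.
  move=> [FK|->] [FK'|->] //; first exact: Fdisj.
    by move=> Kx [i _ ex]; have [_ []] := Le i; rewrite ex; exists K.
  by move=> [i _ ex] K'x; have [_ []] := Le i; rewrite ex; exists K'.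
(* With F empty, L would be all of A, which is infinite. [K0] is the block that receives L. *)
have [K0 FK0] : F !=set0.
  apply/set0P/eqP => F0; apply: infA; move: finL.
  by rewrite /L F0 bigcup_set0 setD0.
pose B (K : set T) := K `|` [set x | L x /\ K = K0].
have BK K : F K -> exists2 e : nat -> T, injective e & range e = B K.
  move=> /Fblock[KA cK iK]; apply: countable_infinite_enum.
    have -> : B K = \bigcup_(D in [set K; [set x | L x /\ K = K0]]) D.
      by rewrite bigcup_setU !bigcup_set1.
    apply: bigcup_countable => [|D [->//|->]]; apply: finite_set_countable => //.
    by apply: sub_finite_set finL => x [].
  by apply: sub_infinite_set iK => x; left.
have [e eP] := choice (fun j : {K | F K} => (exists2P _ _).1 (BK _ (svalP j))).
exists {K | F K}, e; split.
- move=> j i; have : B (sval j) (e j i) by rewrite -(eP j).2; exists i.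
  by case=> [|[[]//]]; case: (Fblock _ (svalP j)) => + _ _; exact.
- move=> x Ax; suff [j Bx] : exists j : {K | F K}, B (sval j) x.
    by move: Bx; rewrite -(eP j).2 => -[i _ <-]; exists j, i.
  have [[K FK Kx]|nFx] := pselect ((\bigcup_(K in F) K) x).
    by exists (exist _ K FK); left.
  by exists (exist _ K0 FK0); right.
- move=> j j' i i' ee'; suff jj' : j = j'.
    by split=> //; move: ee'; rewrite jj'; exact: (eP j').1.
  have : B (sval j) (e j i) by rewrite -(eP j).2; exists i.
  have : B (sval j') (e j i) by rewrite ee' -(eP j').2; exists i'.
  move: (e j i) => x; case: j j' {ee'} => [K FK] [K' FK'] /= BK'x BKx.
  apply: eq_exist.
  case: BKx BK'x => [Kx|[[_ nFx] ->]] [K'x|[[_ nFx'] ->]] //.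
  - exact: Fdisj Kx K'x.
  - by case: nFx'; exists K.
  - by case: nFx; exists K'.
Qed.

(** * Isomorphism of s with its nonzero powers, and conjugacy *)

Section InfinitelyManyComponents.
Variables (X : Type) (s : permutation X).
Hypothesis s_acyclic : forall (x : X) (n : int), 1 <= n -> iterz s n x <> x.
Hypothesis infinite_components : infinite_set (components s).

Lemma component_eq x y : component s x y -> component s y = component s x.
Proof.
move=> [n _ <-]; apply/seteqP; split=> _ [m _ <-].
  by exists (m + n) => //; rewrite iterzD.
by exists (m - n) => //; rewrite -iterzD subrK.
Qed.

Lemma component_refl x : component s x x.
Proof. by exists 0. Qed.

(** One representative per component gives an infinite transversal; its blocks supply j and i, and z
    is the power of s leading from the representative to the point, unique by acyclicity. *)
Lemma components_coordinates : exists (J : Type) (mk : J * nat * int -> X),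
  bijective mk /\ forall j i z, mk (j, i, 1 + z) = s (mk (j, i, z)).
Proof.
have [_ [x0 _ _]] := infinite_setN0 infinite_components.
have /choice[c cP] (K : set X) : exists x, components s K -> K x.
  have [[x _ <-]|nK] := pselect (components s K); last by exists x0.
  by exists x => _; exact: component_refl.
have compc K : components s K -> component s (c K) = K.
  by move=> cK; have := cP _ cK; case: cK => x _ <- /component_eq.
have [J [e [eR Re einj]]] : exists (J : Type) (e : J -> nat -> X),
    [/\ forall j i, (c @` components s) (e j i),
        forall x, (c @` components s) x -> exists j i, e j i = x &
        forall j j' i i', e j i = e j' i' -> j = j' /\ i = i'].
  apply: infinite_set_nat_blocks; rewrite (eq_finite_set (inj_card_eq _)) //.
  by move=> K K' /set_mem cK /set_mem cK' /(congr1 (component s)); rewrite !compc.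
exists J, (fun p => iterz s p.2 (e p.1.1 p.1.2)); split; last first.
  by move=> j i z; rewrite /= iterz1D.
rewrite -setTT_bijective; split=> // [[[j i] z] [[j' i'] z'] _ _ /= ee'|x _].
  have [[K cK eK] [K' cK' eK']] := (eR j i, eR j' i').
  have KK' : K = K'.
    rewrite -(compc _ cK) -(compc _ cK') eK eK'.
    by rewrite -(component_eq (x := e j' i') (y := e j i)) //; exists (- z + z');
      rewrite // iterzD -ee' iterzNK.
  have er : e j i = e j' i' by rewrite -eK -eK' KK'.
  have [-> ->] := einj _ _ _ _ er; congr (_, _).
  by apply: (iterz_injl s_acyclic (x := e j i)); rewrite ee' er.
have [n _ nx] : component s x (c (component s x)).
  by apply: cP; exists x.
have [|j [i eji]] := Re (c (component s x)); first by exists (component s x) => //; exists x.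
by exists ((j, i), - n) => //=; rewrite eji -nx iterzNK.
Qed.

(* In the coordinates (j, i, z), z runs along an orbit of s, i numbers the
   orbits of a countable family and j the families. *)
Definition split_orbits (J : Type) (n : int) (p : J * nat * int) : J * nat * int :=
  let: (j, i, z) := p in
  (j, (i %/ `|n|)%N, z * n + (i %% `|n|)%N%:Z).

(* s^n cuts each orbit of s into |n| orbits; grouping the blocks of |n|
   consecutive s-orbits inside a countable family absorbs this factor. *)
Lemma split_orbits_bij (J : Type) (n : int) : n != 0 -> bijective (@split_orbits J n).
Proof.
move=> n0; have an0 : (0 < `|n|)%N by rewrite absz_gt0.
(* The inverse is Euclidean division by n; the remainder lies in [0, |n|) for negative n too. *)
exists (fun p => (p.1.1, (p.1.2 * `|n| + `|(p.2 %% n)%Z|)%N, (p.2 %/ n)%Z)).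
  move=> [[j i] z] /=.
  have r_small : (0 <= (i %% `|n|)%N%:Z < `|n|%N%:Z) by rewrite ltz_nat ltn_mod.
  rewrite modzMDl divzMDl // /modz divz_small -?abszE // mul0r subr0 addr0.
  by rewrite absz_nat -divn_eq.
move=> [[j i] z] /=.
have r_lt : (`|(z %% n)%Z| < `|n|)%N.
  by rewrite -ltz_nat gez0_abs ?modz_ge0 // ltz_mod.
rewrite divnMDl // divn_small // addn0 modnMDl modn_small //.
by rewrite gez0_abs ?modz_ge0 // -divz_eq.
Qed.

(** In coordinates s adds 1 to z, and [split_orbits] turns this into adding n, which is the action
    of s^n. *)
Lemma isomorphic_iterz (n : int) : n <> 0 -> isomorphic s (iterz s n).
Proof.
move=> /eqP n0; have [J [mk [mk_bij mkS]]] := components_coordinates.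
have [g mkK gK] := mk_bij.
have mkD j i m z : mk (j, i, m + z) = iterz s m (mk (j, i, z)).
  elim/int_ind: m => [|m IHm|m IHm]; first by rewrite add0r.
    by rewrite intS -addrA mkS IHm iterz1D.
  apply: (@permutation_inj _ s); rewrite -mkS -iterz1D intS addrA.
  by rewrite opprD !addrA subrr !add0r.
have phi_bij : bijective (mk \o @split_orbits J n \o g).
  by apply: bij_comp; [apply: bij_comp (split_orbits_bij J n0)|exists mk].
have [phi phiE] := PbijTT phi_bij; exists phi; rewrite -phiE.
apply/funext => x /=; rewrite -(gK x).
by case: (g x) => [[j i] z]; rewrite -mkS !mkK /= mulrDl mul1r -addrA mkD.
Qed.

End InfinitelyManyComponents.

(** If phi carries s to f and psi carries s to g, then psi o phi^-1 carries f to g, and conjugation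
    by it carries Pol(f) to Pol(g). *)
Lemma isomorphic_conjugate (X : Type) (s f g : X -> X) :
  isomorphic s f -> isomorphic s g -> conjugate (Pol_set f) (Pol_set g).
Proof.
move=> [phi phif] [psi psig].
have phi_bij : bijective (psi \o (phi^-1)%FUN).
  by apply: bij_comp.
have [p pE] := PbijTT phi_bij.
have pf x : p (f x) = g (p x).
  have /(congr1 (fun h => h ((phi^-1)%FUN x))) /= := phif.
  have /(congr1 (fun h => h ((phi^-1)%FUN x))) /= := psig.
  by rewrite permutationVK -pE /= => <- <-; rewrite permutationK.
have pVg x : (p^-1)%FUN (g x) = f ((p^-1)%FUN x).
  by apply: (can_inj (permutationK p)); rewrite pf !permutationVK.
exists p; apply/seteqP; split=> [[k o] go|_ [[k o] fo <-] a] /=.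
  exists (Op (fun x => (p^-1)%FUN (o (p \o x)))) => [a /=|].
    rewrite -pVg -go; congr ((p^-1)%FUN (o _)).
    by apply/funext => i /=; rewrite pf.
  congr existT; apply/funext => x /=; rewrite permutationVK; congr o.
  by apply/funext => i /=; rewrite permutationVK.
rewrite -pf -fo; congr (p (o _)).
by apply/funext => i /=; rewrite pVg.
Qed.
Local Close Scope ring_scope.

(** * The lattice isomorphism with divisibility and its consequences *)

Theorem theorem1p4 (X : Type) (X_infinite : infinite_set [set: X])
    (s : permutation X)
    (s_acyclic : forall (x : X) (n : int), (1 <= n)%R -> iterz s n x <> x) :
  let C1 : localClone X := Pol s in
  let PolS : nat -> localClone X := fun n => Pol (iterz s n%:Z) in
  [/\ (* (N, |) has smallest element 1 and greatest element 0 *)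
      (forall n : nat, 1 %| n) /\ (forall n : nat, n %| 0),
      (* the local clones containing C1 form an interval of the lattice *)
      [set C : localClone X | C1 `<=` C] = [set` `[C1, \top]%O],
      (* n |-> Pol(s^n) is a lattice isomorphism onto that interval *)
      [/\ set_bij [set: nat] [set C : localClone X | C1 `<=` C] PolS,
          forall m n : nat, m %| n <-> PolS m `<=` PolS n,
          forall m n : nat, PolS (gcdn m n) = (PolS m `&` PolS n)%O
        & forall m n : nat, PolS (lcmn m n) = (PolS m `|` PolS n)%O],
      (* there is no precomplete local clone above C1 *)
      ~ (exists P : localClone X, precomplete P /\ C1 `<=` P)
    & (* the case of infinitely many components *)
      infinite_set (components s) ->
      (forall n : int, n <> 0%R -> isomorphic s (iterz s n)) /\
      (forall C D : localClone X,
         C1 `<=` C -> C `<` setT -> C1 `<=` D -> D `<` setT -> conjugate C D)].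
Proof.
move=> C1 PolS.
have [x0 _] := infinite_setN0 X_infinite.
have subE m n : m %| n <-> PolS m `<=` PolS n.
  exact: (iff_sym (Pol_iterz_subP s_acyclic x0 m n)).
have C1PolS n : C1 `<=` PolS n by exact/(subE 1%N)/dvd1n.
have PolS_inj m n : PolS m = PolS n -> m = n.
  by move=> mn; apply/eqP; rewrite eqn_dvd; apply/andP; split; apply/subE; rewrite mn.
have PolS0 : PolS 0 = \top%O by apply: val_inj; exact: Pol_set_iterz0.
have leE m n : (PolS m <= PolS n)%O = (m %| n).
  by apply/idP/idP; rewrite le_localCloneE => /subE.
have aboveP (C : localClone X) : C1 `<=` C -> exists d, C = PolS d.
  exact: (local_clone_above_Pol s_acyclic).
split=> //.
- by apply/seteqP; split=> C /=; rewrite in_itv /= lex1 andbT le_localCloneE.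
- split=> // [|m n|m n].
  + split=> [n _|m n _ _ /PolS_inj//|C /aboveP[d ->]]; first exact: C1PolS.
    by exists d.
  (* The meet contains C1, so it is some [PolS k], and its universal property becomes that of the
     gcd through [leE]. Joins and lcm are handled likewise. *)
  + have [k kE] : exists k, (PolS m `&` PolS n)%O = PolS k.
      by apply: aboveP => o oC1; split; exact: C1PolS.
    apply/eqP; rewrite eq_le lexI !leE dvdn_gcdl dvdn_gcdr /= kE leE dvdn_gcd.
    by rewrite -!leE -kE leIl leIr.
  + have [k kE] : exists k, (PolS m `|` PolS n)%O = PolS k.
      apply: aboveP; apply: subset_trans (C1PolS m) _.
      by rewrite -le_localCloneE leUl.
    apply/eqP; rewrite eq_le leUx !leE dvdn_lcml dvdn_lcmr andbT kE leE dvdn_lcm.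
    by rewrite -!leE -kE leUl leUr.
- move=> [P [[Ptop Pmax] /aboveP[d dE]]]; subst P.
  have d0 : d != 0%N by apply: contra_notN Ptop => /eqP->.
  (* For d nonzero, Pol(s^(2d)) lies strictly between Pol(s^d) and the full clone. *)
  have [|/PolS_inj d2|] := Pmax (PolS (2 * d)); first by rewrite leE dvdn_mull.
    by lia.
  by rewrite -PolS0 => /PolS_inj; lia.
- move=> inf_comp; split=> [n n0|C D C1C Cprop C1D Dprop]; first exact: isomorphic_iterz.
  have isoE (E : localClone X) : C1 `<=` E -> E `<` [set: _] ->
      exists2 n : nat, E = PolS n & isomorphic s (iterz s n).
    move=> /aboveP[n ->] [_ nT]; exists n => //; apply: isomorphic_iterz => // n0.
    by apply: nT; case: n0 => ->; rewrite PolS0.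
  have [m -> isom] := isoE C C1C Cprop; have [n -> ison] := isoE D C1D Dprop.
  exact: isomorphic_conjugate isom ison.
Qed.
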